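(* Let $K,L\in\mathcal S^n$, $\phi\in\mathcal C$ and $0\le i<n-1$ ($i$ an integer). Then $$\phi(1)\ \ge\ \phi\left(\left(\frac{\widetilde W_i(K)}{\widetilde W_i(K\widehat+_\phi L)}\right)^{\frac1{n-i}}\right)+\phi\left(\left(\frac{\widetilde W_i(L)}{\widetilde W_i(K\widehat+_\phi L)}\right)^{\frac1{n-i}}\right).$$ If $\phi$ is strictly convex, equality holds if and only if $K$ and $L$ are dilates.
   Context: $\mathcal S^n$ is the set of star bodies (about the origin) in $\mathbb R^n$: compact sets $K$, star-shaped with respect to the origin, whose radial function $\rho(K,u)=\max\{c\ge 0: cu\in K\}$, $u\in S^{n-1}$, is positive and continuous. Two star bodies $K,L$ are dilates if $\rho(K,u)/\rho(L,u)$ is independent of $u\in S^{n-1}$. $S$ denotes spherical Lebesgue measure on $S^{n-1}$. $\mathcal C$ is the class of convex, decreasing functions $\phi:(0,\infty)\to(0,\infty)$ with $\lim_{t\to 0^+}\phi(t)=\infty$ (convention $\phi(0)=\infty$) and $\lim_{t\to\infty}\phi(t)=0$. The dual quermassintegral of $K$ is $\widetilde W_i(K)=\frac1n\int_{S^{n-1}}\rho(K,u)^{n-i}\,dS(u)$. For $K,L\in\mathcal S^n$, the Orlicz harmonic radial sum $K\widehat+_\phi L$ is the star body $M$ whose radial function is determined by $$\phi\left(\frac{\rho(K,u)}{\rho(M,u)}\right)+\phi\left(\frac{\rho(L,u)}{\rho(M,u)}\right)=\phi(1),\qquad u\in S^{n-1}.$$ *)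

(* Defs.v *)
From HB Require Import structures.
From mathcomp Require Import all_boot all_order all_algebra.
From mathcomp Require Import all_classical all_reals all_analysis.
From mathcomp Require Import measurable_realfun.

Set Implicit Arguments.
Unset Strict Implicit.
Unset Printing Implicit Defensive.

Import Order.TTheory GRing.Theory Num.Theory.
Import numFieldNormedType.Exports.

Local Open Scope classical_set_scope.
Local Open Scope ring_scope.

(* The sigma-algebra on 'rV[R]_n is generated by the coordinates; it is the
   Borel sigma-algebra of R^n. *)
Definition rV_display : measure_display. Proof. exact: default_measure_display. Qed.

Section measurable_rV.
Context {R : realType} (n : nat).

Let coords : 'I_n -> 'rV[R]_n -> measurableTypeR R := fun i x => x ord0 i.

Let rV_set0 : g_sigma_preimage coords set0.
Proof. exact: sigma_algebra0. Qed.

Let rV_setC A : g_sigma_preimage coords A -> g_sigma_preimage coords (~` A).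
Proof. exact: sigma_algebraC. Qed.

Let rV_bigcup (F : (set 'rV[R]_n)^nat) :
  (forall i, g_sigma_preimage coords (F i)) ->
  g_sigma_preimage coords (\bigcup_i (F i)).
Proof. exact: sigma_algebra_bigcup. Qed.

HB.instance Definition _ := @isMeasurable.Build rV_display
  'rV[R]_n (g_sigma_preimage coords) rV_set0 rV_setC rV_bigcup.

End measurable_rV.

Section measurable_rV_theory.
Context {R : realType}.

Lemma measurable_coord n (i : 'I_n) :
  measurable_fun [set: 'rV[R]_n] (fun x => x ord0 i : measurableTypeR R).
Proof.
move=> _ Y mY; rewrite setTI; apply: sub_sigma_algebra => /=.
rewrite -bigcup_seq/=; exists i => /=; first by rewrite mem_index_enum.
by exists Y => //; rewrite setTI.
Qed.

Lemma measurable_fun_rVP d (T : measurableType d) n (f : T -> 'rV[R]_n) :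
  measurable_fun [set: T] f <->
  forall i, measurable_fun [set: T] (fun x => f x ord0 i : measurableTypeR R).
Proof.
split=> [mf i|mf].
  exact: (measurableT_comp (measurable_coord i) mf).
pose c := fun (i : 'I_n) (x : 'rV[R]_n) => x ord0 i : measurableTypeR R.
have H : g_sigma_preimage (fun i => c i \o f) `<=` measurable.
  apply: smallest_sub; first exact: sigma_algebra_measurable.
  rewrite -bigcup_seq => A [i _ [B mB <-]]; exact: mf.
move=> _ A mA; apply: H.
by rewrite g_sigma_preimage_comp; exists A.
Qed.

End measurable_rV_theory.

Section lebesgue_rV.
Context {R : realType}.

Definition prepend_coord n (p : 'rV[R]_n * measurableTypeR R) : 'rV[R]_n.+1 :=
  row_mx (p.2 : R)%:M p.1.

Lemma measurable_prepend_coord n :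
  measurable_fun [set: 'rV[R]_n * measurableTypeR R] (@prepend_coord n).
Proof.
apply/measurable_fun_rVP => i; rewrite /prepend_coord.
have [j ->|j ->] := @split_ordP 1 n i.
  rewrite (_ : (fun _ => _) = snd) //; apply/funext => p.
  by apply: (etrans (@row_mxEl _ _ _ _ _ _ _ _)); rewrite mxE (ord1 j) mulr1n.
rewrite (_ : (fun _ => _) =
    (fun x : 'rV[R]_n => x ord0 j : measurableTypeR R) \o fst).
  by apply: measurableT_comp => //; exact: measurable_coord.
by apply/funext => p; exact: (@row_mxEr _ _ _ _ _ _ _ _).
Qed.

Section pushforward_measure_of.
Context d d' (T : measurableType d) (T' : measurableType d').
Variables (mu : {measure set T -> \bar R}) (f : T -> T').
Hypothesis mf : measurable_fun [set: T] f.

Let push := pushforward mu f.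
Let push0 : push set0 = 0%E. Proof. exact: measure0. Qed.
Let push_ge0 A : (0 <= push A)%E. Proof. exact: measure_ge0. Qed.
Let push_sigma_additive : semi_sigma_additive push.
Proof. exact: measure_semi_sigma_additive. Qed.

HB.instance Definition _ :=
  isMeasure.Build _ _ _ push push0 push_ge0 push_sigma_additive.

Definition pushforward_measure : {measure set T' -> \bar R} := push.

End pushforward_measure_of.

(* The n-fold product of Lebesgue measure on R, one coordinate at a time. *)
Fixpoint lebesgue_rV n : {measure set 'rV[R]_n -> \bar R} :=
  match n with
  | 0 => dirac (0 : 'rV[R]_0)
  | m.+1 =>
      pushforward_measure (lebesgue_rV m \x lebesgue_measure)%E
        (@measurable_prepend_coord m)
  end.

End lebesgue_rV.

Section sphere_measure.
Context {R : realType} (n : nat).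
Implicit Types (x : 'rV[R]_n) (A : set 'rV[R]_n).

(* The norm `|x| of the library on 'rV[R]_n is the sup norm. *)
Definition euclid_norm x : R := Num.sqrt (\sum_(j < n) x ord0 j ^+ 2).

Definition unit_sphere : set 'rV[R]_n := [set u | euclid_norm u = 1].

Definition normalize x : 'rV[R]_n := (euclid_norm x)^-1 *: x.

Definition punctured_ball : set 'rV[R]_n := [set x | 0 < euclid_norm x <= 1].

Lemma measurable_sqnorm : measurable_fun [set: 'rV[R]_n]
  (fun x => \sum_(j < n) x ord0 j ^+ 2 : measurableTypeR R).
Proof.
apply: measurable_sum => j; apply: measurable_funX; exact: measurable_coord.
Qed.

Lemma euclid_norm_powR x :
  euclid_norm x = (\sum_(j < n) x ord0 j ^+ 2) `^ 2^-1.
Proof. by rewrite powR12_sqrt// sumr_ge0// => j _; exact: sqr_ge0. Qed.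

Lemma measurable_euclid_norm : measurable_fun [set: 'rV[R]_n]
  (euclid_norm : 'rV[R]_n -> measurableTypeR R).
Proof.
rewrite (_ : euclid_norm =
  (@powR R ^~ 2^-1) \o (fun x => \sum_(j < n) x ord0 j ^+ 2)).
  exact: measurableT_comp (measurable_powR _) measurable_sqnorm.
by apply/funext => x; rewrite euclid_norm_powR.
Qed.

Lemma measurable_normalize : measurable_fun [set: 'rV[R]_n] normalize.
Proof.
apply/measurable_fun_rVP => j; rewrite (_ : (fun _ => _) =
    (fun x => (\sum_(k < n) x ord0 k ^+ 2) `^ (- 2^-1) * x ord0 j)).
  apply: measurable_funM; last exact: measurable_coord.
  exact: measurableT_comp (measurable_powR _) measurable_sqnorm.
by apply/funext => x; rewrite mxE powRN -euclid_norm_powR.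
Qed.

Lemma measurable_punctured_ball : measurable punctured_ball.
Proof.
rewrite (_ : punctured_ball = euclid_norm @^-1` `]0, 1]).
  rewrite -[X in measurable X]setTI.
  exact: (measurable_euclid_norm measurableT (measurable_itv _)).
by apply/seteqP; split => x /=; rewrite in_itv.
Qed.

(* Spherical Lebesgue measure in polar coordinates: S(A) is n times the volume
   of the cone {t u | 0 < t <= 1, u in A} for A a subset of the unit sphere.
   As a measure on R^n it is concentrated on the unit sphere. *)
Definition sphere_measure A : \bar R :=
  (n%:R%:E * lebesgue_rV n (normalize @^-1` A `&` punctured_ball))%E.

Let cone_measure : {measure set 'rV[R]_n -> \bar R} :=
  mscale (n%:R%:nng : {nonneg R})
    (pushforward_measure (mrestr (lebesgue_rV n) measurable_punctured_ball)
      measurable_normalize).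

Let sphere_measure0 : sphere_measure set0 = 0%E.
Proof. exact: (measure0 cone_measure). Qed.

Let sphere_measure_ge0 A : (0 <= sphere_measure A)%E.
Proof. exact: (measure_ge0 cone_measure). Qed.

Let sphere_measure_sigma_additive : semi_sigma_additive sphere_measure.
Proof. exact: (@measure_semi_sigma_additive _ _ _ cone_measure). Qed.

HB.instance Definition _ := isMeasure.Build _ _ _ sphere_measure
  sphere_measure0 sphere_measure_ge0 sphere_measure_sigma_additive.

End sphere_measure.
Arguments unit_sphere {R n}.
Arguments sphere_measure {R n}.

Section star_bodies.
Context {R : realType} {n : nat}.
Implicit Types (K L M : set 'rV[R]_n) (u : 'rV[R]_n).

(* The supremum is a maximum when K is compact and contains the origin. *)
Definition radial K u : R := sup [set c | 0 <= c /\ K (c *: u)].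

Definition star_body K : Prop :=
  [/\ compact K,
      forall x (t : R), K x -> 0 <= t <= 1 -> K (t *: x),
      forall u, unit_sphere u -> 0 < radial K u &
      {within unit_sphere, continuous (radial K)}].

Definition dilates K L : Prop :=
  forall u v, unit_sphere u -> unit_sphere v ->
    radial K u / radial L u = radial K v / radial L v.

Definition dual_quermassintegral (i : nat) K : R :=
  n%:R^-1 * \int[sphere_measure]_(u in unit_sphere) radial K u ^+ (n - i).

(* A definite description, with junk value set0 when no such M exists; a star
   body is determined by its radial function, so M is unique. *)
Definition orlicz_radial_sum (phi : R -> R) K L : set 'rV[R]_n :=
  xget set0 [set M | star_body M /\
    forall u, unit_sphere u ->
      phi (radial K u / radial M u) + phi (radial L u / radial M u) = phi 1].

End star_bodies.

Section orlicz_functions.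
Context {R : realType}.
Implicit Types phi : R -> R.

(* Only the values of phi on the positive half-line are relevant. *)
Definition orlicz_class phi : Prop :=
  [/\ forall t : R, 0 < t -> 0 < phi t,
      convex_function (`]0, +oo[%classic : set R^o) phi,
      forall s t : R, 0 < s -> s < t -> phi t < phi s,
      phi t @[t --> 0^'+] --> +oo &
      phi t @[t --> +oo] --> 0].

Definition strictly_convex phi : Prop :=
  forall s t a : R, 0 < s -> 0 < t -> s != t -> 0 < a < 1 ->
    phi (a * s + (1 - a) * t) < a * phi s + (1 - a) * phi t.

End orlicz_functions.

(* Main.v *)
(* Write k, l, r for the radial functions of K, L and of the Orlicz sum, let
   m = n - i, and let A, B be the m-th roots of the ratios of the integrals of
   k^m and l^m to that of r^m. Composing the tangent line of phi at A, whose
   slope is negative, with Bernoulli's inequality for the m-th power gives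
     phi (k / r) >= phi A - c ((k / r)^m - A^m)   with c > 0,
   with equality only when k / r = A; likewise for l and B. Adding the two,
   multiplying by r^m and integrating over the sphere, the terms in c vanish by
   the choice of A and B, and the inequality remains. In the case of equality
   the integrand is a nonnegative continuous function with zero integral, so
   k / r = A and l / r = B everywhere. *)
Require Import Defs.
From mathcomp Require Import all_boot all_order all_algebra.
From mathcomp Require Import all_classical all_reals all_analysis.
From mathcomp Require Import measurable_realfun ring lra.

Set Implicit Arguments.
Unset Strict Implicit.
Unset Printing Implicit Defensive.

Import Order.TTheory GRing.Theory Num.Theory.
Import numFieldNormedType.Exports.
Local Open Scope classical_set_scope.
Local Open Scope ring_scope.

(** * Roots of powers and the tangent line of a power *)

Lemma powR_expK {R : realType} m (x : R) : (0 < m)%N -> 0 < x ->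
  (x ^+ m) `^ m%:R^-1 = x.
Proof.
move=> m0 x0; rewrite -powR_mulrn ?ltW// -powRrM mulfV ?powRr1 ?ltW//.
by rewrite pnatr_eq0 -lt0n.
Qed.

Lemma powR_invK {R : realType} m (x : R) : (0 < m)%N -> 0 < x ->
  (x `^ m%:R^-1) ^+ m = x.
Proof.
move=> m0 x0; rewrite -powR_mulrn ?powR_ge0// -powRrM mulVf ?powRr1 ?ltW//.
by rewrite pnatr_eq0 -lt0n.
Qed.

(** By induction: multiplying the bound for one exponent by [y] exceeds the tangent for the next by
    a multiple of [(y - x) ^+ 2]. Exponents start at 2 because a first power coincides with its
    tangent. *)
Lemma expr_gt_tangent {R : realFieldType} m (x y : R) :
  0 < x -> 0 < y -> y != x ->
  x ^+ m.+2 + m.+2%:R * x ^+ m.+1 * (y - x) < y ^+ m.+2.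
Proof.
move=> x0 y0 yx; have yx0 : 0 < (y - x) ^+ 2.
  by rewrite exprn_even_gt0//= subr_eq0.
elim: m => [|m IH]; first by move: yx0; rewrite !expr2 expr1; lra.
rewrite [ltRHS]exprS.
apply: (@le_lt_trans _ _ (y * (x ^+ m.+2 + m.+2%:R * x ^+ m.+1 * (y - x)))).
  rewrite -subr_ge0.
  have -> : y * (x ^+ m.+2 + m.+2%:R * x ^+ m.+1 * (y - x)) -
     (x ^+ m.+3 + m.+3%:R * x ^+ m.+2 * (y - x)) =
     m.+2%:R * x ^+ m.+1 * (y - x) ^+ 2.
    by rewrite (exprS x m.+2) (exprS x m.+1); ring.
  by apply: mulr_ge0; [rewrite mulr_ge0 ?exprn_ge0 ?(ltW x0)|exact: ltW].
by rewrite ltr_pM2l.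
Qed.

(** * Convexity of the Orlicz function and the scalar Orlicz equation *)

Section orlicz_functions.
Context {R : realType} (phi : R -> R) (hphi : orlicz_class phi).

Lemma orlicz_gt0 t : 0 < t -> 0 < phi t.
Proof. by case: hphi => + _ _ _ _; apply. Qed.

Lemma orlicz_decr s t : 0 < s -> s < t -> phi t < phi s.
Proof. by case: hphi => _ _ + _ _; apply. Qed.

Lemma orlicz_nincr s t : 0 < s -> s <= t -> phi t <= phi s.
Proof.
by move=> s0; rewrite le_eqVlt => /predU1P[->//|/(orlicz_decr s0)/ltW].
Qed.

(** Convexity with [y] as the convex combination of [x] and [z], cleared of denominators so that
    linear arithmetic can use it. *)
Lemma orlicz_chord x y z : 0 < x -> x < y -> y < z ->
  (z - x) * phi y <= (z - y) * phi x + (y - x) * phi z.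
Proof.
move=> x0 xy yz; case: hphi => _ cvx _ _ _.
have zx0 : 0 < z - x by lra.
have t01 : 0 <= (z - y) / (z - x) <= 1.
  by apply/andP; split; rewrite ?ler_pdivrMr ?divr_ge0//; lra.
pose s := (z - y) / (z - x).
pose t : {i01 R} := Itv01 (proj1 (andP t01)) (proj2 (andP t01)).
have z0 : 0 < z by lra.
have pos w : 0 < w -> w \in (`]0, +oo[%classic : set R^o).
  by rewrite inE/= in_itv/= andbT.
have : phi (s * x + (1 - s) * z) <= s * phi x + (1 - s) * phi z.
  exact: cvx t x z (pos _ x0) (pos _ z0).
have -> : s * x + (1 - s) * z = y by rewrite /s; field; lra.
have -> : (z - y) * phi x + (y - x) * phi z =
    (z - x) * (s * phi x + (1 - s) * phi z) by rewrite /s; field; lra.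
by rewrite ler_pM2l.
Qed.

Lemma orlicz_continuous x : 0 < x -> {for x, continuous phi}.
Proof.
move=> x0.
(* A Lipschitz bound to the right of [x / 2]: by convexity no chord there falls more steeply than
   one starting at [x / 4], and positivity of [phi] bounds the latter's drop by [phi (x / 4)]. *)
have lip y z : x / 2 < y -> y <= z ->
    phi y - phi z <= (z - y) * (phi (x / 4) / (x / 4)).
  move=> xy; rewrite le_eqVlt => /predU1P[->|yz]; first by rewrite !subrr mul0r.
  have x4 : 0 < x / 4 by lra.
  have x4y : x / 4 < y by lra.
  have H := orlicz_chord x4 x4y yz.
  have pz : 0 < phi z by apply: orlicz_gt0; lra.
  have py : phi z < phi y by apply: orlicz_decr; lra.
  rewrite mulrA ler_pdivlMr; last lra.
  have : (x / 4) * (phi y - phi z) <= (z - x / 4) * (phi y - phi z).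
    by rewrite ler_pM2r; lra.
  by have : 0 < (z - y) * phi z; [rewrite mulr_gt0; lra|lra].
apply/cvgrPdist_lt => e e0.
set C := phi (x / 4) / (x / 4) in lip.
have C0 : 0 < C by rewrite divr_gt0 ?orlicz_gt0; lra.
near=> y.
have xy : x / 2 < y.
  by near: y; apply: lt_nbhsr => //; lra.
have d : `|x - y| < e / C.
  by near: y; apply: (@cvgr_dist_lt _ _ _ _ _ id) => //; rewrite divr_gt0.
have [le|/ltW le] := leP x y.
- have px : phi y <= phi x by apply: orlicz_nincr.
  rewrite ger0_norm ?subr_ge0//; apply: le_lt_trans (lip _ _ _ le) _; first lra.
  move: d; rewrite ler0_norm ?subr_le0// opprB => d.
  by rewrite -ltr_pdivlMr.
- have px : phi x <= phi y by apply: orlicz_nincr => //; lra.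
  rewrite ler0_norm ?subr_le0// opprB; apply: le_lt_trans (lip _ _ xy le) _.
  move: d; rewrite ger0_norm ?subr_ge0// => d.
  by rewrite -ltr_pdivlMr.
Unshelve. all: by end_near. Qed.

(** Slopes of chords ending at [x] from the left are bounded by those of chords leaving [x] to the
    right, so the supremum [sup E] of the former is the slope of a support line. The chord from [x]
    to [x + 1] descends, which makes that slope negative. *)
Lemma orlicz_subgradient x : 0 < x ->
  exists2 c, 0 < c & forall y, 0 < y -> phi x - c * (y - x) <= phi y.
Proof.
move=> x0.
pose E := [set (phi y - phi x) / (y - x) | y in [set y | 0 < y < x]].
have ubE z : x < z -> ubound E ((phi z - phi x) / (z - x)).
  move=> xz _ [y /andP[y0 yx] <-].
  rewrite -[leLHS]mulrNN -invrN !opprB ler_pdivrMr; last lra.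
  rewrite mulrAC ler_pdivlMr; last lra.
  by have := orlicz_chord y0 yx xz; lra.
have E0 : E !=set0.
  by exists ((phi (x / 2) - phi x) / (x / 2 - x)), (x / 2) => //=; lra.
have supE : has_sup E.
  split=> //; exists ((phi (x + 1) - phi x) / (x + 1 - x)); apply: ubE; lra.
have c0 : sup E < 0.
  apply: (@le_lt_trans _ _ ((phi (x + 1) - phi x) / (x + 1 - x))).
    by apply: ge_sup => //; apply: ubE; lra.
  have -> : x + 1 - x = 1 by ring.
  by rewrite divr1 subr_lt0; apply: orlicz_decr => //; lra.
exists (- sup E) => [|y y0]; first lra.
have [yx|xy|->] := ltgtP y x; last by lra.
- have : (phi y - phi x) / (y - x) <= sup E.
    by apply: ub_le_sup; [case: supE|exists y => //=; rewrite y0].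
  by rewrite ler_ndivrMr; lra.
- have : sup E <= (phi y - phi x) / (y - x) by apply: ge_sup => //; exact: ubE.
  by rewrite ler_pdivlMr; lra.
Qed.

Lemma orlicz_sum_incr {a b r s} : 0 < a -> 0 < b -> 0 < r -> r < s ->
  phi (a / r) + phi (b / r) < phi (a / s) + phi (b / s).
Proof.
move=> a0 b0 r0 rs; have s0 : 0 < s by lra.
by apply: ltrD; apply: orlicz_decr; rewrite ?divr_gt0// ltr_pM2l// ltf_pV2.
Qed.

Lemma orlicz_sum_inj {a b r s} : 0 < a -> 0 < b -> 0 < r -> 0 < s ->
  phi (a / r) + phi (b / r) = phi (a / s) + phi (b / s) -> r = s.
Proof.
move=> a0 b0 r0 s0 E; have [rs|sr|//] := ltgtP r s.
  by have := orlicz_sum_incr a0 b0 r0 rs; rewrite E ltxx.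
by have := orlicz_sum_incr a0 b0 s0 sr; rewrite E ltxx.
Qed.

(** Intermediate value theorem in the variable [s], the inverse of [r]. At [a^-1] the first term
    alone is already [phi 1]; for large [s] both terms are below [phi 1 / 2]. *)
Lemma orlicz_sum_ex a b : 0 < a -> 0 < b ->
  exists2 r, 0 < r & phi (a / r) + phi (b / r) = phi 1.
Proof.
move=> a0 b0; pose h s := phi (a * s) + phi (b * s).
have p1 : 0 < phi 1 by exact: orlicz_gt0.
have h1 : phi 1 <= h a^-1.
  rewrite /h divff ?gt_eqF// lerDl ltW// orlicz_gt0//.
  by rewrite divr_gt0.
have [T T0 hT] : exists2 T, 0 < T & forall s, T < s -> phi s < phi 1 / 2.
  case: hphi => _ _ _ _ /cvgrPdist_lt/(_ _ (divr_gt0 p1 (ltr0Sn R 1))).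
  move=> [T [_ HT]]; exists (Num.max T 1); first by rewrite lt_max ltr01 orbT.
  move=> s; rewrite gt_max => /andP[Ts s1].
  by have := HT s Ts; rewrite sub0r normrN gtr0_norm// orlicz_gt0; lra.
(* The first two summands push [a * s1] and [b * s1] beyond [T]; the third keeps [s1] to the right
   of [a^-1]. *)
pose s1 := (T + 1) / a + (T + 1) / b + a^-1.
have T1a : 0 < (T + 1) / a by rewrite divr_gt0; lra.
have T1b : 0 < (T + 1) / b by rewrite divr_gt0; lra.
have a1 : 0 < a^-1 by rewrite invr_gt0.
have big c : 0 < c -> (T + 1) / c <= s1 -> T < c * s1.
  by move=> c0; rewrite ler_pdivrMr// mulrC; lra.
have hs1 : h s1 <= phi 1.
  have : phi (a * s1) < phi 1 / 2 by apply/hT/big => //; rewrite /s1; lra.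
  have : phi (b * s1) < phi 1 / 2 by apply/hT/big => //; rewrite /s1; lra.
  by rewrite /h; lra.
have le1 : a^-1 <= s1 by rewrite /s1; lra.
have cth : {within `[a^-1, s1], continuous h}.
  apply: continuous_in_subspaceT => s; rewrite inE/= in_itv/= => /andP[as1 _].
  have s0 : 0 < s by lra.
  have cts (c : R) : 0 < c -> {for s, continuous (fun y : R => phi (c * y))}.
  move=> c0; apply: (@continuous_comp R R R (fun y => c * y) phi).
    exact: mulrl_continuous.
  by apply: orlicz_continuous; exact: mulr_gt0.
by apply: cvgD; apply: cts.
have [|c + hc] := @IVT _ h _ _ (phi 1) le1 cth.
  by rewrite ge_min hs1 orbT/= le_max h1.
rewrite in_itv/= => /andP[ca _].
by exists c^-1; rewrite ?invr_gt0 ?invrK//; lra.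
Qed.

(** The Orlicz equation is homogeneous and monotone. If [k * r' < r], the sum for [a], [b] at
    [k * r'] would be below the common value, yet [a / (k * r') <= a' / r'] and its analogue for [b]
    put it above. This is the source of the continuity of the radial sum. *)
Lemma orlicz_sum_mono {a b r a' b' r'} :
  0 < a -> 0 < b -> 0 < r -> 0 < a' -> 0 < b' -> 0 < r' ->
  phi (a / r) + phi (b / r) = phi (a' / r') + phi (b' / r') ->
  forall k, 0 < k -> a <= k * a' -> b <= k * b' -> r <= k * r'.
Proof.
move=> a0 b0 r0 a'0 b'0 r'0 E k k0 ak bk; rewrite leNgt; apply/negP => kr.
have kr0 : 0 < k * r' by exact: mulr_gt0.
have := orlicz_sum_incr a0 b0 kr0 kr; rewrite E ltNge => /negP; apply.
have H c c' : 0 < c -> c <= k * c' -> phi (c' / r') <= phi (c / (k * r')).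
  move=> c0 cc'; apply: orlicz_nincr; first exact: divr_gt0.
  by rewrite ler_pdivrMr// mulrA mulrAC divfK ?gt_eqF// mulrC.
by apply: lerD; apply: H.
Qed.

(* The tangent of [phi] at [x] is decreasing, so it can be composed with the
   tangent of [y ^+ m] at [x]. *)
Lemma orlicz_tangent m x : (1 < m)%N -> 0 < x ->
  exists2 c, 0 < c & forall y, 0 < y ->
    phi x - c * (y ^+ m - x ^+ m) <= phi y ?= iff (y == x).
Proof.
case: m => [|[|m]]// _ x0; have [d d0 hd] := orlicz_subgradient x0.
have D0 : 0 < m.+2%:R * x ^+ m.+1 by rewrite mulr_gt0// exprn_gt0.
(* The steepness of the support line of [phi] divided by the derivative of the power at [x]. *)
exists (d / (m.+2%:R * x ^+ m.+1)); first exact: divr_gt0.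
move=> y y0; have [->|yx] := eqVneq y x.
  by rewrite subrr mulr0 subr0; split; rewrite ?eqxx.
suff lt : phi x - d / (m.+2%:R * x ^+ m.+1) * (y ^+ m.+2 - x ^+ m.+2) < phi y.
  by split; [exact: ltW|rewrite lt_eqF].
apply: lt_le_trans (hd _ y0); rewrite ltrD2l ltrN2.
rewrite -mulrA ltr_pM2l// mulrC ltr_pdivlMr//.
by have := expr_gt_tangent m x0 y0 yx; lra.
Qed.

End orlicz_functions.

(** * Borel sets of the space and topology of the Euclidean sphere *)

Section row_vectors.
Context {R : realType} {n : nat}.
Implicit Types (x u : 'rV[R]_n) (e : R).

Lemma ball_rVP (c x : 'rV[R]_n) (e : R) : 0 < e ->
  ball c e x <-> forall j, ball (c ord0 j) e (x ord0 j).
Proof.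
move=> e0; split=> [[_ cx] j|cx]; first exact: cx.
by split=> // i j; rewrite (ord1 i); exact: cx.
Qed.

(** Balls are taken in the sup norm, so each is a finite intersection of coordinate slabs. *)
Lemma measurable_ball_rV (c : 'rV[R]_n) (e : R) : measurable (ball c e).
Proof.
have [e0|e0] := leP e 0.
  rewrite (_ : ball c e = set0)//; apply/seteqP; split=> // x [].
  by rewrite ltNge e0.
have -> : ball c e = \bigcap_(j in [set: 'I_n])
    ((fun x : 'rV[R]_n => x ord0 j : measurableTypeR R) @^-1` ball (c ord0 j) e).
  apply/seteqP; split=> x /=.
    by move=> /(ball_rVP _ _ e0) cx j _; exact: cx.
  by move=> cx; apply/ball_rVP => // j; exact: cx.
apply: fin_bigcap_measurable; first exact: finite_finset.
move=> j _; rewrite -[X in measurable X]setTI.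
by apply: measurable_coord => //; rewrite ball_itv; exact: measurable_itv.
Qed.

(** An open set is the countable union of the balls inside it with rational centre and radius of the
    form [k.+1%:R^-1]. *)
Lemma open_measurable_rV (U : set 'rV[R]_n) : open U -> measurable U.
Proof.
move=> oU.
pose B (p : 'rV[rat]_n * nat) : set 'rV[R]_n :=
  ball (map_mx ratr p.1 : 'rV[R]_n) (p.2.+1%:R^-1).
have -> : U = \bigcup_p (if pselect (B p `<=` U) then B p else set0).
  apply/seteqP; split=> [x Ux|x [p _ /=]]; last first.
    by case: pselect => [BU /BU|_ []].
  have /nbhs_ballP[e /= e0 eU] : nbhs x U by apply: open_nbhs_nbhs.
  (* With radius below [e / 2], a rational ball containing [x] stays inside the ball of radius [e]
     around [x]. *)
  have [k ke] : exists k : nat, k.+1%:R^-1 < e / 2.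
    exists (Num.truncn (e / 2)^-1).
    by rewrite invf_plt ?posrE ?divr_gt0// truncnS_gt.
  have : 0 < k.+1%:R^-1 :> R by rewrite invr_gt0.
  move: ke; set d : R := k.+1%:R^-1 => de d0.
  have /choice[q hq] : forall j : 'I_n, exists q : rat,
      ball (x ord0 j) d (ratr q).
    move=> j; have xk : x ord0 j - d < x ord0 j + d by lra.
    have [q] := rat_in_itvoo xk; rewrite in_itv/= => /andP[q1 q2].
    by exists q; rewrite /ball/= ltr_norml; apply/andP; split; lra.
  exists (\row_j q j, k) => //; case: pselect => [_|[]] /=.
    by apply/ball_rVP => // j; rewrite !mxE; apply: ball_sym.
  move=> y /= qy; apply: eU.
  apply: (@ball_splitr _ _ (map_mx ratr (\row_j q j) : 'rV[R]_n)).
    apply/ball_rVP; rewrite ?divr_gt0// => j; rewrite !mxE.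
    by apply: ball_sym; apply: le_ball (hq j); exact: ltW.
  by apply: le_ball qy; exact: ltW.
apply: countable_bigcupT_measurable; first exact: countableP.
by move=> p; case: pselect => ? /=; [exact: measurable_ball_rV|exact: measurable0].
Qed.

Lemma within_continuous_measurable_rV (D : set 'rV[R]_n) (f : 'rV[R]_n -> R) :
  measurable D -> {within D, continuous f} ->
  measurable_fun D (f : _ -> measurableTypeR R).
Proof.
move=> mD cf; have {}cf := (@continuousP (subspace D) R f).1 cf.
apply: (measurability _ (RGenOpens.measurableE R)).
move=> _ [_ [a [b ->] <-]].
have /open_subspaceP[V oV VD] := cf _
  (@interval_open _ (BRight a) (BLeft b) isT isT).
by rewrite setIC -VD; apply: measurableI => //; exact: open_measurable_rV.
Qed.

Lemma euclid_norm_continuous : continuous (@euclid_norm R n).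
Proof.
move=> x; apply: (@continuous_comp _ R R (fun x : 'rV[R]_n =>
  \sum_(j < n) x ord0 j ^+ 2) Num.sqrt); last exact: sqrt_continuous.
move: x; apply: (@continuous_big R 'I_n +%R 0 xpredT) => [|j _ x].
  exact: add_continuous.
apply: (@continuous_comp _ R R (fun x : 'rV[R]_n => x ord0 j) (@GRing.exp R ^~ 2)).
  exact: coord_continuous.
exact: exprn_continuous.
Qed.

Lemma euclid_normZ (c : R) x : euclid_norm (c *: x) = `|c| * euclid_norm x.
Proof.
rewrite /euclid_norm -sqrtr_sqr -sqrtrM ?sqr_ge0// mulr_sumr.
by congr Num.sqrt; apply: eq_bigr => j _; rewrite mxE exprMn.
Qed.

Lemma coord_le_euclid_norm x j : `|x ord0 j| <= euclid_norm x.
Proof.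
rewrite -sqrtr_sqr ler_wsqrtr// (bigD1 j)//= lerDl.
by apply: sumr_ge0 => k _; exact: sqr_ge0.
Qed.

Lemma closed_unit_sphere : closed (unit_sphere : set 'rV[R]_n).
Proof.
rewrite (_ : unit_sphere = @euclid_norm R n @^-1` [set 1])//.
apply: preimage_closed; last exact: closed_eq.
by move=> x _; exact: euclid_norm_continuous.
Qed.

Lemma measurable_unit_sphere : measurable (unit_sphere : set 'rV[R]_n).
Proof.
rewrite -[X in measurable X]setCK; apply: measurableC; apply: open_measurable_rV.
by apply: closed_openC; exact: closed_unit_sphere.
Qed.

(** The Euclidean norm dominates the sup norm, so the closed sphere is also bounded for the
    latter. *)
Lemma compact_unit_sphere : compact (unit_sphere : set 'rV[R]_n).
Proof.
apply: bounded_closed_compact closed_unit_sphere.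
exists 1; split=> // M M1 x /= x1.
rewrite [leLHS]/Num.norm/= mx_normrE; apply/bigmax_leP; split=> [|[i j] _].
  by rewrite (le_trans ler01)// ltW.
by rewrite (ord1 i)/= (le_trans (coord_le_euclid_norm _ _))// x1 ltW.
Qed.

Lemma normalize_continuous x : 0 < euclid_norm x ->
  {for x, continuous (@normalize R n)}.
Proof.
move=> x0.
apply: (@continuousZ _ _ _ (fun x => (euclid_norm x)^-1) (fun x : 'rV[R]_n => x)).
  by apply: continuousV; [rewrite gt_eqF|exact: euclid_norm_continuous].
exact: cvg_id.
Qed.

Lemma unit_sphere_normalize x : 0 < euclid_norm x -> unit_sphere (normalize x).
Proof.
move=> x0; rewrite /unit_sphere/= euclid_normZ ger0_norm ?invr_ge0 ?ltW//.
by rewrite mulVf// gt_eqF.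
Qed.

Lemma normalizeZ (c : R) u : 0 < c -> unit_sphere u -> normalize (c *: u) = u.
Proof.
move=> c0 u1; rewrite /normalize euclid_normZ u1 mulr1 gtr0_norm//.
by rewrite scalerA mulVf ?gt_eqF// scale1r.
Qed.

End row_vectors.

(** * Finiteness and positivity of the spherical measure *)

Section sphere_measure.
Context {R : realType}.

(** A sup norm ball is a cube of side [e *+ 2], and its preimage under [prepend_coord] is a product
    of a lower-dimensional cube and an interval. The value serves both to bound the measure of the
    sphere and to show that open parts of it are not null. *)
Lemma lebesgue_rV_ball n (c : 'rV[R]_n) (e : R) : 0 < e ->
  lebesgue_rV n (ball c e) = ((e *+ 2) ^+ n)%:E.
Proof.
move=> e0; elim: n c => [|n IH] c.
  rewrite /= diracE mem_set//; apply/ball_rVP => // j.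
  by have := ltn_ord j.
rewrite /= /pushforward.
pose c1 : 'rV[R]_n := @rsubmx _ 1 1 n c.
have -> : @prepend_coord R n @^-1` ball c e = ball c1 e `*` ball (c ord0 ord0) e.
  apply/seteqP; split=> -[x t] /=.
    move=> /(ball_rVP _ _ e0) H; split.
      apply/ball_rVP => // j; have := H (@rshift 1 n j).
      by rewrite /prepend_coord /= (@row_mxEr _ 1 1 n) /c1 mxE.
    have := H (@lshift 1 n ord0).
    rewrite /prepend_coord /= (@row_mxEl _ 1 1 n) mxE mulr1n.
    by rewrite (_ : lshift n ord0 = ord0)//; exact: val_inj.
  move=> [/(ball_rVP _ _ e0) H1 H2]; apply/ball_rVP => // j.
  have [k ->|k ->] := @split_ordP 1 n j.
    rewrite /prepend_coord /= (@row_mxEl _ 1 1 n) mxE (ord1 k) mulr1n.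
    by rewrite (_ : lshift n ord0 = ord0)//; exact: val_inj.
  by have := H1 k; rewrite /prepend_coord /= (@row_mxEr _ 1 1 n) /c1 mxE.
rewrite product_measure1E ?IH; first last.
- by rewrite ball_itv; exact: measurable_itv.
- exact: measurable_ball_rV.
by rewrite exprSr EFinM; congr (_ * _)%E; exact: lebesgue_measure_ball (ltW e0).
Qed.

Context {n : nat}.
Local Notation S := (unit_sphere : set 'rV[R]_n).
Implicit Types (u : 'rV[R]_n) (f : 'rV[R]_n -> R).

Lemma sphere_measure_fin : (sphere_measure S < +oo)%E.
Proof.
(* Radius 2 rather than 1, because the ball is open while the punctured ball contains points of norm
   1. *)
have : (lebesgue_rV n (@normalize R n @^-1` S `&` @punctured_ball R n) <=
    lebesgue_rV n (ball (0%R : 'rV[R]_n) 2%R))%E.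
  apply: le_measure; rewrite ?inE.
  - apply: measurableI; last exact: measurable_punctured_ball.
    rewrite -[X in measurable X]setTI.
    by apply: measurable_normalize => //; exact: measurable_unit_sphere.
  - exact: measurable_ball_rV.
  move=> x [_ /andP[_ x1]]; apply/ball_rVP => // j.
  rewrite mxE /ball/= sub0r normrN.
  by apply: le_lt_trans (coord_le_euclid_norm _ _) _; apply: le_lt_trans x1 _; lra.
rewrite lebesgue_rV_ball// => fin.
apply: (@le_lt_trans _ _ (n%:R%:E * ((2 *+ 2) ^+ n)%:E)%E); last by rewrite ltry.
by apply: lee_wpmul2l => //; rewrite lee_fin.
Qed.

Lemma sphere_integrable f : {within S, continuous f} ->
  (@sphere_measure R n).-integrable S (EFin \o f).
Proof.
move=> cf; apply: measurable_bounded_integrable.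
- exact: measurable_unit_sphere.
- exact: sphere_measure_fin.
- by apply: within_continuous_measurable_rV => //; exact: measurable_unit_sphere.
have /compact_bounded[M [Mr HM]] := continuous_compact cf compact_unit_sphere.
by exists M; split=> // t Mt u Su; apply: HM => //; exists u.
Qed.

(** The cone over a relatively open part of the sphere contains a small cube around an interior
    point of the ball. *)
Lemma sphere_measure_gt0 u0 (U : set 'rV[R]_n) : S u0 -> open U -> U u0 ->
  (0 < sphere_measure (S `&` U))%E.
Proof.
move=> Su0 oU Uu0.
(* In dimension 0 the sphere is empty, which contradicts [Su0]. *)
have n0 : (0 < n)%N.
  case: n u0 Su0 {U oU Uu0} => // u0.
  rewrite /unit_sphere/= /euclid_norm big_ord0 sqrtr0.
  by move=> /esym/eqP; rewrite oner_eq0.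
(* Half of [u0] lies strictly between the origin and the sphere, where [normalize] is continuous. *)
pose x0 := 2^-1 *: u0.
have x0E : euclid_norm x0 = 2^-1 by rewrite euclid_normZ Su0 mulr1 ger0_norm.
have nU : nbhs x0 (@normalize R n @^-1` U).
  apply: normalize_continuous; first by rewrite x0E.
  by rewrite normalizeZ//; exact: open_nbhs_nbhs.
have n1 : nbhs x0 (@euclid_norm R n @^-1` `]0, 1[%classic).
  apply: euclid_norm_continuous; apply: open_nbhs_nbhs; split.
    exact: interval_open.
  by rewrite /= in_itv/= x0E; apply/andP; split; lra.
have /nbhs_ballP[e /= e0 eB] : nbhs x0 ((@normalize R n @^-1` U) `&`
  (@euclid_norm R n @^-1` `]0, 1[%classic)) by exact: filterI.
rewrite mule_gt0 ?lte_fin ?ltr0n//.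
apply: (@lt_le_trans _ _ (lebesgue_rV n (ball x0 e))).
  by rewrite lebesgue_rV_ball// lte_fin exprn_gt0// pmulrn_lgt0.
have mU := open_measurable_rV oU.
apply: le_measure; rewrite ?inE.
- exact: measurable_ball_rV.
- apply: measurableI; last exact: measurable_punctured_ball.
  rewrite -[X in measurable X]setTI; apply: measurable_normalize => //.
  by apply: measurableI => //; exact: measurable_unit_sphere.
move=> x /eB[/= Ux]; rewrite in_itv/= => /andP[xgt0 xlt1].
split; last by rewrite /punctured_ball/= xgt0 ltW.
by split=> //; exact: unit_sphere_normalize.
Qed.

(** By continuity [f] exceeds half of [f u0] on a relatively open neighbourhood of [u0], which has
    positive measure. *)
Lemma sphere_integral_gt0 f u0 : {within S, continuous f} ->
  (forall u, S u -> 0 <= f u) -> S u0 -> 0 < f u0 ->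
  0 < \int[sphere_measure]_(u in S) f u.
Proof.
move=> cf f0 Su0 fu0.
have mS := @measurable_unit_sphere R n.
have intf := sphere_integrable cf.
pose d := f u0 / 2; have d0 : 0 < d by rewrite divr_gt0.
have /open_subspaceP[U oU US] := (@continuousP (subspace S) R f).1 cf _
  (@interval_open _ (BRight d) +oo%O isT isT).
have Uu0 : U u0.
  have : (U `&` S) u0 by rewrite US; split=> //=; rewrite in_itv/= andbT /d; lra.
  by case.
have mU := open_measurable_rV oU.
have : (0 < \int[sphere_measure]_(u in S) (f u)%:E)%E.
  apply: (@lt_le_trans _ _ (\int[sphere_measure]_(u in S `&` U) d%:E)%E).
    rewrite integral_cst; last exact: measurableI.
    by rewrite mule_gt0// (sphere_measure_gt0 Su0).
  apply: (@le_trans _ _ (\int[sphere_measure]_(u in S `&` U) (f u)%:E)%E).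
    have mf := (measurable_int _ intf).
    apply: ge0_le_integral => //=.
    - exact: measurableI.
    - by move=> u _; rewrite lee_fin ltW.
    - by apply: measurable_funS mf => // u [].
    move=> u [Su Uu]; have : (U `&` S) u by [].
    rewrite US => -[/= + _]; rewrite in_itv/= andbT lee_fin.
    exact: ltW.
  apply: ge0_subset_integral => //=; first exact: measurableI.
  exact: (measurable_int _ intf).
move=> int0; apply: fine_gt0; rewrite int0/= -ge0_fin_numE ?ltW//.
exact: integrable_fin_num.
Qed.

End sphere_measure.

(** * Existence and continuity of the Orlicz radial sum *)

Section star_bodies.
Context {R : realType}.

(** Near [x] the values of [a] and [b] change at most by a factor [1 + k] in either direction;
    [orlicz_sum_mono] transfers this factor to [r]. *)
Lemma orlicz_sum_continuous {T : topologicalType} (phi : R -> R) (D : set T)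
    (a b r : T -> R) : orlicz_class phi ->
  (forall x, D x -> [/\ 0 < a x, 0 < b x & 0 < r x]) ->
  (forall x, D x -> phi (a x / r x) + phi (b x / r x) = phi 1) ->
  {within D, continuous a} -> {within D, continuous b} ->
  {within D, continuous r}.
Proof.
move=> hphi pos eqr /subspace_continuousP ca /subspace_continuousP cb.
apply/subspace_continuousP => x Dx; have [a0 b0 r0] := pos _ Dx.
apply/cvgrPdist_lt => e e0.
(* Chosen so that [k * r x] is [e / 2]. *)
pose k := e / r x / 2; have k0 : 0 < k by rewrite !divr_gt0.
have near_ratio (f : T -> R) :
    f y @[y --> within D (nbhs x)] --> f x -> 0 < f x ->
    \forall y \near within D (nbhs x),
      f y <= (1 + k) * f x /\ f x <= (1 + k) * f y.
  (* This tolerance gives the lower factor exactly, since [1 - k / (1 + k)] is the inverse of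
     [1 + k]; the upper factor follows from [k / (1 + k) <= k]. *)
  move=> cf f0; have d0 : 0 < f x * (k / (1 + k)).
    by rewrite !mulr_gt0// invr_gt0; lra.
  have : \forall y \near within D (nbhs x), `|f x - f y| < f x * (k / (1 + k)).
    by move/cvgrPdist_lt : cf; apply.
  apply: filterS => y; rewrite ltr_norml => /andP[].
  have k1 : (k / (1 + k)) * (1 + k) = k by rewrite divfK// gt_eqF//; lra.
  set q := k / (1 + k) in k1 d0 *; have q0 : 0 < q by rewrite /q divr_gt0//; lra.
  have qk : q <= k.
    by rewrite -subr_ge0 -k1; have := mulr_gt0 q0 k0; lra.
  move=> h1 h2; have fq : f x * q <= f x * k by rewrite ler_pM2l.
  split; first lra.
  have : (f x - f y) * (1 + k) <= f x * k.
    rewrite (_ : f x * k = f x * q * (1 + k)); last by rewrite -mulrA k1.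
    by rewrite ler_pM2r; lra.
  lra.
have na := near_ratio a (ca _ Dx) a0; have nb := near_ratio b (cb _ Dx) b0.
have nD : \forall y \near within D (nbhs x), D y by exact: withinT.
near=> y; change (`|r x - r y| < e).
have Dy : D y by near: y.
have [ay1 ay2] : a y <= (1 + k) * a x /\ a x <= (1 + k) * a y by near: y.
have [by1 by2] : b y <= (1 + k) * b x /\ b x <= (1 + k) * b y by near: y.
have [ya0 yb0 yr0] := pos _ Dy.
have E : phi (a x / r x) + phi (b x / r x) = phi (a y / r y) + phi (b y / r y).
  by rewrite !eqr.
have k1 : 0 < 1 + k by lra.
have xy := orlicz_sum_mono hphi a0 b0 r0 ya0 yb0 yr0 E k1 ay2 by2.
have yx := orlicz_sum_mono hphi ya0 yb0 yr0 a0 b0 r0 (esym E) k1 ay1 by1.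
have ke : k * r x = e / 2 by rewrite /k; field; rewrite gt_eqF.
have [le|/ltW le] := leP (r x) (r y); last first.
  have : k * r y <= k * r x by rewrite ler_pM2l.
  by rewrite ger0_norm; lra.
by rewrite ler0_norm; lra.
Unshelve. all: by end_near. Qed.

Context {n : nat}.
Local Notation S := (unit_sphere : set 'rV[R]_n).

Lemma star_body_radial (r : 'rV[R]_n -> R) :
  {within S, continuous r} -> (forall u, S u -> 0 < r u) ->
  exists2 M, star_body M & forall u, S u -> radial M u = r u.
Proof.
move=> cr r0.
(* The union of the segments from the origin to the points [r u *: u], written as a continuous image
   of a compact product so that compactness is immediate. *)
pose M : set 'rV[R]_n := (fun p : R * 'rV[R]_n => p.1 *: p.2) @`
  (`[0, 1]%classic `*` ((fun u => r u *: u) @` S)).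
have ME u c : S u -> 0 <= c -> M (c *: u) <-> c <= r u.
  move=> Su c0; split=> [[[t _] /= [+ [v Sv <-]]]|cru].
    rewrite in_itv/= => /andP[t0 t1]; rewrite scalerA => E.
    have ct : t * r v = c.
      have := congr1 (@euclid_norm R n) E; rewrite !euclid_normZ Su Sv !mulr1.
      by rewrite !ger0_norm// mulr_ge0// ltW// r0.
    (* At [c = 0] the direction is lost; otherwise normalizing both sides of [E] recovers it. *)
    have [->|c1] := eqVneq c 0; first by rewrite ltW// r0.
    have cpos : 0 < c by rewrite lt_neqAle eq_sym c1.
    have <- : v = u by rewrite -(normalizeZ cpos Sv) -ct E normalizeZ.
    by rewrite -ct ler_piMl// ltW// r0.
  have ru0 := r0 _ Su; exists (c / r u, r u *: u) => /=.
    split; last by exists u.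
    by rewrite /= in_itv/= divr_ge0 ?(ltW ru0)//= ler_pdivrMr// mul1r.
  by rewrite scalerA divfK// gt_eqF.
have radM u : S u -> radial M u = r u.
  move=> Su; have ru0 := r0 _ Su.
  have Mr : [set c | 0 <= c /\ M (c *: u)] (r u).
    by split; [exact: ltW|apply/ME => //; exact: ltW].
  have ubr : ubound [set c | 0 <= c /\ M (c *: u)] (r u).
    by move=> c [c0 /(ME _ _ Su c0)].
  apply/eqP; rewrite eq_le; apply/andP; split.
    by apply: ge_sup => //; exists (r u).
  by apply: ub_le_sup => //; exists (r u).
exists M => //; split.
- apply: continuous_compact.
    apply: continuous_subspaceT => -[t v].
    by apply: (@cvgZ _ _ _ (nbhs (t, v)) _ fst snd); [exact: cvg_fst|exact: cvg_snd].
  apply: compact_setX; first exact: segment_compact.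
  apply: continuous_compact compact_unit_sphere.
  apply/subspace_continuousP => u Su; apply: cvgZ.
    by move/subspace_continuousP : cr; apply.
  exact: cvg_within.
- move=> x t [[s v] /= [+ Cv] <-] /andP[t0 t1]; rewrite in_itv/= => /andP[s0 s1].
  exists (t * s, v); last by rewrite scalerA.
  by split=> //=; rewrite in_itv/= mulr_ge0//= mulr_ile1.
- by move=> u Su; rewrite radM// r0.
- apply: subspace_eq_continuous cr => u; rewrite inE => Su.
  by change (r u = radial M u); rewrite radM.
Qed.

(** Solving the scalar equation in each direction gives a continuous radial function, hence a star
    body; so the description defining the sum is satisfied and its default value does not arise. *)
Lemma orlicz_radial_sumP (phi : R -> R) (K L : set 'rV[R]_n) :
  orlicz_class phi -> star_body K -> star_body L ->
  let M := orlicz_radial_sum phi K L in star_body M /\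
    forall u, S u ->
      phi (radial K u / radial M u) + phi (radial L u / radial M u) = phi 1.
Proof.
move=> hphi [_ _ K0 cK] [_ _ L0 cL] M.
apply: (xgetPex set0 (P := [set M | star_body M /\ _])).
have /choice[r hr] : forall u, exists r, S u -> 0 < r /\
    phi (radial K u / r) + phi (radial L u / r) = phi 1.
  move=> u; have [Su|nSu] := pselect (S u); last by exists 0.
  by have [r] := orlicz_sum_ex hphi (K0 _ Su) (L0 _ Su); exists r.
have r0 u : S u -> 0 < r u by move=> /hr[].
have [|N sN rN] := @star_body_radial r _ r0.
  apply: (orlicz_sum_continuous hphi _ _ cK cL) => u Su.
    by split; [exact: K0|exact: L0|exact: r0].
  by have [] := hr u Su.
by exists N; split=> // u Su; rewrite rN//; have [] := hr u Su.
Qed.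

End star_bodies.

(** * The integrated tangent inequality and its equality case *)

Section sphere_integrals.
Context {R : realType} {n : nat}.
Local Notation S := (unit_sphere : set 'rV[R]_n).
Implicit Types (f g : 'rV[R]_n -> R).

Lemma within_continuousX f m : {within S, continuous f} ->
  {within S, continuous (fun u => f u ^+ m)}.
Proof.
move=> /subspace_continuousP cf; apply/subspace_continuousP => u Su.
exact: (cvg_comp f (@GRing.exp R ^~ m) (cf _ Su) (@exprn_continuous R m (f u))).
Qed.

Lemma within_continuous_lin f g a : {within S, continuous f} ->
  {within S, continuous g} -> {within S, continuous (fun u => a * f u + g u)}.
Proof.
move=> /subspace_continuousP cf /subspace_continuousP cg.
apply/subspace_continuousP => u Su; apply: cvgD (cg _ Su).
by apply: cvgM (cf _ Su); exact: cvg_cst.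
Qed.

Lemma sphere_integral_lin f g a : {within S, continuous f} ->
  {within S, continuous g} ->
  \int[sphere_measure]_(u in S) (a * f u + g u) =
  a * \int[sphere_measure]_(u in S) f u + \int[sphere_measure]_(u in S) g u.
Proof.
move=> cf cg; have mS := @measurable_unit_sphere R n.
have caf : {within S, continuous (fun u => a * f u)}.
  move/subspace_continuousP : cf => cf; apply/subspace_continuousP => u Su.
  by apply: cvgM (cf _ Su); exact: cvg_cst.
rewrite RintegralD//; [|exact: sphere_integrable..].
by rewrite RintegralZl//; exact: sphere_integrable.
Qed.

Lemma orlicz_sum_norm_inequality (phi : R -> R) m
    (k l r : 'rV[R]_n -> R) u0 A B :
  orlicz_class phi -> (1 < m)%N -> S u0 ->
  {within S, continuous k} -> {within S, continuous l} ->
  {within S, continuous r} ->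
  (forall u, S u -> [/\ 0 < k u, 0 < l u & 0 < r u]) ->
  (forall u, S u -> phi (k u / r u) + phi (l u / r u) = phi 1) ->
  0 < A -> 0 < B ->
  A ^+ m * \int[sphere_measure]_(u in S) (r u ^+ m) =
    \int[sphere_measure]_(u in S) (k u ^+ m) ->
  B ^+ m * \int[sphere_measure]_(u in S) (r u ^+ m) =
    \int[sphere_measure]_(u in S) (l u ^+ m) ->
  phi A + phi B <= phi 1 /\
  (phi 1 = phi A + phi B -> forall u, S u -> k u / r u = A /\ l u / r u = B).
Proof.
move=> hphi m1 Su0 ck cl cr pos eqr A0 B0 EA EB.
have [c c0 hc] := orlicz_tangent hphi m1 A0.
have [d d0 hd] := orlicz_tangent hphi m1 B0.
(* [g] is the sum of the two tangent gaps times [r u ^+ m], with the constants collected in [a]. The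
   final [+ 0] gives each stage the shape expected by the linearity lemmas. *)
pose a := phi 1 - (phi A + phi B) - c * A ^+ m - d * B ^+ m.
pose g u := a * r u ^+ m + (c * k u ^+ m + (d * l u ^+ m + 0)).
have ckm := within_continuousX (m := m) ck.
have clm := within_continuousX (m := m) cl.
have crm := within_continuousX (m := m) cr.
have cont0 : {within S, continuous (fun _ : 'rV[R]_n => 0 : R)}.
  by apply: continuous_subspaceT; exact: cst_continuous.
have cgl := within_continuous_lin (a := d) clm cont0.
have cgk := within_continuous_lin (a := c) ckm cgl.
have cg : {within S, continuous g} by exact: within_continuous_lin crm cgk.
have r_pos : 0 < \int[sphere_measure]_(u in S) (r u ^+ m).
  apply: (sphere_integral_gt0 (u0 := u0) crm) => // [u Su|].
    by have [_ _ r0] := pos _ Su; rewrite exprn_ge0// ltW.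
  by have [_ _ r0] := pos _ Su0; rewrite exprn_gt0.
have intg : \int[sphere_measure]_(u in S) g u =
    (phi 1 - (phi A + phi B)) * \int[sphere_measure]_(u in S) (r u ^+ m).
  rewrite (sphere_integral_lin a crm cgk) (sphere_integral_lin c ckm cgl).
  rewrite (sphere_integral_lin d clm cont0) -EA -EB.
  rewrite Rintegral_cst; last exact: measurable_unit_sphere.
  by rewrite mul0r addr0 /a; ring.
have gE u : S u -> g u =
    (phi (k u / r u) - (phi A - c * ((k u / r u) ^+ m - A ^+ m)) +
     (phi (l u / r u) - (phi B - d * ((l u / r u) ^+ m - B ^+ m)))) * r u ^+ m.
  move=> Su; have [_ _ r0] := pos _ Su; rewrite /g /a -(eqr u Su) !expr_div_n.
  have : r u ^+ m != 0 by rewrite expf_neq0// gt_eqF.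
  move: (phi (k u / r u)) (phi (l u / r u)) (phi A) (phi B) => p q pA pB.
  by move: (r u ^+ m) (k u ^+ m) (l u ^+ m) => x y z x0; field.
have g0 u : S u -> 0 <= g u.
  move=> Su; have [k0 l0 r0] := pos _ Su.
  have [hk _] := hc _ (divr_gt0 k0 r0); have [hl _] := hd _ (divr_gt0 l0 r0).
  rewrite gE//; apply: mulr_ge0; last by rewrite exprn_ge0// ltW.
  by rewrite addr_ge0 ?subr_ge0.
split.
  by rewrite -subr_ge0 -(pmulr_lge0 _ r_pos) -intg; exact: Rintegral_ge0.
move=> E u Su; have [k0 l0 r0] := pos _ Su.
have gu : g u = 0.
  apply/eqP; rewrite eq_le g0// andbT leNgt; apply/negP => gu.
  have := sphere_integral_gt0 cg g0 Su gu.
  by rewrite intg E subrr mul0r ltxx.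
have [hk ek] := hc _ (divr_gt0 k0 r0); have [hl el] := hd _ (divr_gt0 l0 r0).
move/eqP : gu; rewrite gE// mulf_eq0 (gt_eqF (exprn_gt0 m r0)) orbF.
(* Both gaps are nonnegative with zero sum, so each vanishes and the equality conditions of the
   tangent bounds apply. *)
rewrite paddr_eq0 ?subr_ge0// !subr_eq0 ![phi (_ / _) == _]eq_sym ek el.
by case/andP => /eqP -> /eqP ->.
Qed.

End sphere_integrals.

(** * Passage to dual quermassintegrals, and dilates *)

Theorem corollary6p5 (R : realType) (n i : nat) (phi : R -> R)
    (K L : set 'rV[R]_n)
    (hi : (i < n - 1)%N) (hphi : orlicz_class phi)
    (hK : star_body K) (hL : star_body L) :
  let W := dual_quermassintegral i in
  let KL := orlicz_radial_sum phi K L in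
  let rhs := phi ((W K / W KL) `^ (n - i)%:R^-1)
             + phi ((W L / W KL) `^ (n - i)%:R^-1) in
  phi 1 >= rhs /\ (strictly_convex phi -> (phi 1 = rhs <-> dilates K L)).
Proof.
move=> W KL rhs.
have n0 : (0 < n)%N by case: n hi {K L hK hL W KL rhs} => //; rewrite ltn0.
have m1 : (1 < n - i)%N by rewrite ltn_subRL addnC -ltn_subRL.
have [sM eqM] := orlicz_radial_sumP hphi hK hL; rewrite -/KL in sM eqM.
case: hK => _ _ K0 cK; case: hL => _ _ L0 cL; case: sM => _ _ M0 cM.
rewrite {}/rhs {}/W /dual_quermassintegral.
move: m1; set m := (n - i)%N => m1; have m0 : (0 < m)%N by exact: ltnW.
have [u0 Su0] : exists u0 : 'rV[R]_n, unit_sphere u0.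
  exists (delta_mx ord0 (Ordinal n0)); rewrite /unit_sphere/= /euclid_norm.
  rewrite (bigD1 (Ordinal n0))//= big1 => [|j /negbTE j0].
    by rewrite addr0 mxE !eqxx expr1n sqrtr1.
  by rewrite mxE j0 andbF expr0n.
pose I (X : set 'rV[R]_n) :=
  \int[sphere_measure]_(u in unit_sphere) radial X u ^+ m.
have cX X : {within unit_sphere, continuous (radial X)} ->
    {within unit_sphere, continuous (fun u : 'rV[R]_n => radial X u ^+ m)}.
  exact: within_continuousX.
have I0 X : (forall u, unit_sphere u -> 0 < radial X u) ->
    {within unit_sphere, continuous (radial X)} -> 0 < I X.
  move=> X0 cont; apply: (@sphere_integral_gt0 _ _ _ u0 (cX _ cont)) => // [u Su|].
    by rewrite exprn_ge0// ltW// X0.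
  by rewrite exprn_gt0// X0.
have IK := I0 _ K0 cK; have IL := I0 _ L0 cL; have IM := I0 _ M0 cM.
have WE X : (n%:R^-1 * I X) / (n%:R^-1 * I KL) = I X / I KL.
  by rewrite -mulf_div divff ?mul1r// invr_eq0 pnatr_eq0 -lt0n.
rewrite -!/(I _) !WE.
have A0 : 0 < (I K / I KL) `^ m%:R^-1 by rewrite powR_gt0// divr_gt0.
have B0 : 0 < (I L / I KL) `^ m%:R^-1 by rewrite powR_gt0// divr_gt0.
have AE : ((I K / I KL) `^ m%:R^-1) ^+ m * I KL = I K.
  by rewrite powR_invK ?divr_gt0// divfK// gt_eqF.
have BE : ((I L / I KL) `^ m%:R^-1) ^+ m * I KL = I L.
  by rewrite powR_invK ?divr_gt0// divfK// gt_eqF.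
have pos u : unit_sphere u ->
    [/\ 0 < radial K u, 0 < radial L u & 0 < radial KL u].
  by move=> Su; rewrite K0// L0// M0.
have [le fixed] :=
  orlicz_sum_norm_inequality hphi m1 Su0 cK cL cM pos eqM A0 B0 AE BE.
split=> // _; split=> [E u v Su Sv|dil].
  have [uK uL] := fixed E _ Su; have [vK vL] := fixed E _ Sv.
  (* With [z] the radial function of the sum, the ratio for [K] and [L] becomes a quotient of the
     two constants supplied by [fixed]. *)
  have div x y z : z != 0 -> x / y = (x / z) / (y / z) :> R.
    by move=> z0; rewrite invf_div mulrA divfK.
  rewrite (div _ (radial L u) _ (lt0r_neq0 (M0 _ Su))).
  by rewrite (div _ (radial L v) _ (lt0r_neq0 (M0 _ Sv))) uK uL vK vL.
(* For dilates, [K] is [q] times [L] radially; the aim is to show that the sum is [s] times [L]. *)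
pose q := radial K u0 / radial L u0.
pose s := radial KL u0 / radial L u0.
have q0 : 0 < q by rewrite divr_gt0// ?K0 ?L0.
have s0 : 0 < s by rewrite divr_gt0// ?M0 ?L0.
have KE u : unit_sphere u -> radial K u = q * radial L u.
  by move=> Su; rewrite /q -(dil u u0 Su Su0) divfK// gt_eqF// L0.
have eqs u : unit_sphere u ->
    phi (q / (radial KL u / radial L u)) +
    phi (1 / (radial KL u / radial L u)) = phi 1.
  move=> Su; rewrite -(eqM u Su) (KE u Su) !invf_div mul1r.
  by rewrite mulrA.
have sE u : unit_sphere u -> radial KL u = s * radial L u.
  move=> Su; have su0 : 0 < radial KL u / radial L u by rewrite divr_gt0// ?M0 ?L0.
  (* By [eqs] the ratio of the sum to [L] solves one and the same scalar equation in every
     direction, and its solution is unique. *)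
  have -> : s = radial KL u / radial L u.
    by apply: (orlicz_sum_inj hphi q0 ltr01 s0 su0); rewrite !eqs.
  by rewrite divfK// gt_eqF// L0.
have scale X p : 0 < p ->
    (forall u, unit_sphere u -> radial X u = p * radial KL u) ->
    (I X / I KL) `^ m%:R^-1 = p.
  move=> p0 XE; rewrite -[RHS](powR_expK m0 p0); congr (_ `^ _).
  apply: (mulIf (lt0r_neq0 IM)); rewrite divfK ?gt_eqF// /I.
  rewrite -RintegralZl; [|exact: measurable_unit_sphere|
    exact/sphere_integrable/cX].
  by apply: eq_Rintegral => u; rewrite inE => Su; rewrite XE// exprMn.
(* Relative to the sum, [K] and [L] have factors [q / s] and [s^-1], so the claim reduces to the
   defining equation at [u0]. *)
rewrite (scale K (q / s)) ?(scale L s^-1).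
- by rewrite -(eqs u0 Su0) mul1r.
- by rewrite invr_gt0.
- by move=> u Su; rewrite sE// mulKf// gt_eqF.
- by rewrite divr_gt0.
- by move=> u Su; rewrite sE// KE// mulrA divfK// gt_eqF.
Qed.
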